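(* Let $\mathbf{F}_d:\mathbb{R}^n\to\mathbb{R}^d$ be the (discretized) parameter-to-observable map, let $\tilde{\mathbf{F}}_d:\mathbb{R}^n\to\mathbb{R}^d$ be its derivative-informed projected neural network (DIPNet) surrogate, let $\mu_{\text{pr}}$ be the prior, and let $\mathbf{W}\in\mathcal{W}$ be a design matrix, all as described in the context. Assume that the parameter-to-observable map $\mathbf{F}_d$ and its surrogate $\tilde{\mathbf{F}}_d$ are bounded as $$\mathbb{E}_{\mathbf{m}\sim\mu_{\text{pr}}}\big[\|\mathbf{F}_d(\mathbf{m})\|^2\big]<\infty\quad\text{and}\quad \mathbb{E}_{\mathbf{m}\sim\mu_{\text{pr}}}\big[\|\tilde{\mathbf{F}}_d(\mathbf{m})\|^2\big]<\infty.$$ Moreover, assume that the generalization error of the DIPNet surrogate can be bounded by $\varepsilon$, i.e., $$\mathbb{E}_{\mathbf{m}\sim\mu_{\text{pr}}}\big[\|\mathbf{F}_d(\mathbf{m})-\tilde{\mathbf{F}}_d(\mathbf{m})\|^2\big]\le\varepsilon^2.$$ Then the error in the approximation of the normalization constant by the DIPNet surrogate can be bounded by $$|\hat\pi(\mathbf{y}_i,\mathbf{W})-\tilde\pi(\mathbf{y}_i,\mathbf{W})|\le C_i\,\varepsilon,$$ for sufficiently large $n_{\text{in}}$ and some constants $0<C_i<\infty$, $i=1,\dots,n_{\text{out}}$. Moreover, the approximation error for the expected information gain can be bounded by $$|\Psi^{dl}(\mathbf{W})-\Psi^{nn}(\mathbf{W})|\le C\,\varepsilon$$ for some constant $0<C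<\infty$.
   Context: Parameter and map: $\mathbf{m}\in\mathbb{R}^n$ is the coefficient vector of a finite element discretization of an uncertain parameter field, with Gaussian prior $\mu_{\text{pr}}=\mathcal{N}(\mathbf{m}_{\text{pr}},\mathbf{\Gamma}_{\text{pr}})$. The map $\mathbf{F}_d:\mathbb{R}^n\to\mathbb{R}^d$ sends $\mathbf{m}$ to the values, at $d$ candidate sensor locations, of the solution of a PDE model with parameter $\mathbf{m}$. $\|\cdot\|$ is the Euclidean norm (or the induced matrix norm). DIPNet surrogate: $\tilde{\mathbf{F}}_d(\mathbf{m})=\mathbf{\Phi}\,\mathbf{f}(\mathbf{V}^T\mathbf{m},\mathbf{w})+\mathbf{b}$. The columns of $\mathbf{V}\in\mathbb{R}^{n\times r_M}$ are the generalized eigenvectors for the $r_M$ largest eigenvalues of $\big[\int\nabla\mathbf{F}_d(\mathbf{m})^T\nabla\mathbf{F}_d(\mathbf{m})\,d\mu_{\text{pr}}(\mathbf{m})\big]\mathbf{v}=\lambda\,\mathbf{\Gamma}_{\text{pr}}^{-1}\mathbf{v}$ (active subspace). The columns of $\mathbf{\Phi}\in\mathbb{R}^{d\times r_F}$ are the eigenvectors for the $r_F$ largest eigenvalues of $\int\mathbf{F}_d(\mathbf{m})\mathbf{F}_d(\mathbf{m})^T\,d\mu_{\text{pr}}(\mathbf{m})$ (proper orthogonal decomposition). $\mathbf{f}$ is a trained (residual) neural network with weights $\mathbf{w}$, mapping $\mathbb{R}^{r_M}$ to $\mathbb{R}^{r_F}$, and $\mathbf{b}\in\mathbb{R}^d$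 is a bias. Designs: choosing $r$ sensors out of the $d$ candidates is represented by a matrix in $$\mathcal{W}=\Big\{\mathbf{W}\in\mathbb{R}^{r\times d}:\ \mathbf{W}_{ij}\in\{0,1\},\ \sum_{i=1}^r\mathbf{W}_{ij}\in\{0,1\},\ \sum_{j=1}^d\mathbf{W}_{ij}=1\Big\}.$$ The parameter-to-observable map for the design is $\mathbf{W}\mathbf{F}_d$. Likelihood: the observation noise is $\mathcal{N}(\mathbf{0},\mathbf{\Gamma}_{\text{n}})$ on $\mathbb{R}^r$, with invertible covariance matrix $\mathbf{\Gamma}_{\text{n}}$, and $\|\mathbf{z}\|^2_{\mathbf{\Gamma}_{\text{n}}^{-1}}=\mathbf{z}^T\mathbf{\Gamma}_{\text{n}}^{-1}\mathbf{z}$. Omitting the Gaussian normalization factor, which cancels in the expected information gain, $$\pi_{\text{like}}(\mathbf{y}\,|\,\mathbf{m},\mathbf{W})=\exp\Big(-\tfrac12\|\mathbf{y}-\mathbf{W}\mathbf{F}_d(\mathbf{m})\|^2_{\mathbf{\Gamma}_{\text{n}}^{-1}}\Big).$$ Samples: $\mathbf{m}_i$, $i=1,\dots,n_{\text{out}}$, are i.i.d. samples from $\mu_{\text{pr}}$ (outer loop), and $\mathbf{y}_i=\mathbf{W}\mathbf{F}_d(\mathbf{m}_i)+\boldsymbol{\varepsilon}_i$ are data realizations with i.i.d. noise $\boldsymbol{\varepsilon}_i\sim\mathcal{N}(\mathbf{0},\mathbf{\Gamma}_{\text{n}})$. For each $i$, $\mathbf{m}_{i,j}$, $j=1,\dots,n_{\text{in}}$,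 are i.i.d. samples from $\mu_{\text{pr}}$ (inner loop). Monte Carlo estimators of the normalization constant (model evidence), with the true map and with the surrogate: $$\hat\pi(\mathbf{y}_i,\mathbf{W})=\frac1{n_{\text{in}}}\sum_{j=1}^{n_{\text{in}}}\pi_{\text{like}}(\mathbf{y}_i\,|\,\mathbf{m}_{i,j},\mathbf{W}),\qquad \tilde\pi(\mathbf{y}_i,\mathbf{W})=\frac1{n_{\text{in}}}\sum_{j=1}^{n_{\text{in}}}\exp\Big(-\tfrac12\|\mathbf{y}_i-\mathbf{W}\tilde{\mathbf{F}}_d(\mathbf{m}_{i,j})\|^2_{\mathbf{\Gamma}_{\text{n}}^{-1}}\Big).$$ Double-loop Monte Carlo estimators of the expected information gain (the Kullback–Leibler divergence from prior to posterior averaged over the data), with the true map and with the surrogate: $$\Psi^{dl}(\mathbf{W})=\frac1{n_{\text{out}}}\sum_{i=1}^{n_{\text{out}}}\log\frac{\pi_{\text{like}}(\mathbf{y}_i\,|\,\mathbf{m}_i,\mathbf{W})}{\hat\pi(\mathbf{y}_i,\mathbf{W})},\qquad \Psi^{nn}(\mathbf{W})=\frac1{n_{\text{out}}}\sum_{i=1}^{n_{\text{out}}}\log\frac{\pi_{\text{like}}(\mathbf{y}_i\,|\,\mathbf{m}_i,\mathbf{W})}{\tilde\pi(\mathbf{y}_i,\mathbf{W})}.$$ *)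

(* Defs.v *)
From HB Require Import structures.
From mathcomp Require Import all_boot all_order all_algebra.
From mathcomp Require Import all_classical all_reals all_analysis.

Set Implicit Arguments.
Unset Strict Implicit.
Unset Printing Implicit Defensive.

Import Order.TTheory GRing.Theory Num.Theory.
Import numFieldNormedType.Exports.

Local Open Scope classical_set_scope.
Local Open Scope ring_scope.

(* Borel sigma-algebra of the (norm) topology on matrices, hence on R^n, which
   is represented by the column vectors 'cV[R]_n. *)
Section borel_matrix.
Context {R : realType} (m n : nat).

Let opens : set (set 'M[R]_(m, n)) := [set A | open A].

Let borel0 : <<s opens >> set0.
Proof. exact: sigma_algebra0. Qed.

Let borelC A : <<s opens >> A -> <<s opens >> (~` A).
Proof. exact: sigma_algebraC. Qed.

Let borel_bigcup (F : (set 'M[R]_(m, n))^nat) :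
  (forall i, <<s opens >> (F i)) -> <<s opens >> (\bigcup_i F i).
Proof. exact: sigma_algebra_bigcup. Qed.

HB.instance Definition _ := @isMeasurable.Build (sigma_display opens)
  'M[R]_(m, n) <<s opens >> borel0 borelC borel_bigcup.

End borel_matrix.

(* The library norm `|x| on matrices is the sup norm; this is the squared
   Euclidean norm. *)
Definition sqnorm {R : realType} {n} (x : 'cV[R]_n) : R :=
  \sum_(i < n) x i 0 ^+ 2.

Section gaussian.
Context {R : realType}.

Definition covariance_mx {n} (G : 'M[R]_n) : Prop :=
  G^T = G /\ forall x : 'cV[R]_n, 0 <= (x^T *m G *m x) 0 0.

(* N(a, v) on the real line, v being the variance; the library's normal_prob
   takes the standard deviation and is not a Dirac mass when it is 0. *)
Definition normal_law (a v : R) : set R -> \bar R :=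
  if v == 0 then \d_a else normal_prob a (Num.sqrt v).

(* mu = N(m0, G): every linear functional x |-> a^T x has law
   N(a^T m0, a^T G a). *)
Definition gaussian {n} (mu : probability 'cV[R]_n R)
    (m0 : 'cV[R]_n) (G : 'M[R]_n) : Prop :=
  forall (a : 'cV[R]_n) (A : set R), measurable A ->
    mu [set x | A ((a^T *m x) 0 0)] =
    normal_law ((a^T *m m0) 0 0) ((a^T *m G *m a) 0 0) A.

End gaussian.

Section iid.
Context {R : realType} {d1 d2 : measure_display}
  {Omega : measurableType d1} {T : measurableType d2}.

Definition mutually_independent (P : probability Omega R) {I : eqType}
    (X : I -> Omega -> T) : Prop :=
  forall (s : seq I) (A : I -> set T), uniq s ->
    (forall i, measurable (A i)) ->
    P (\big[setI/setT]_(i <- s) (X i @^-1` A i)) =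
    (\prod_(i <- s) P (X i @^-1` A i))%E.

Definition iid_samples (P : probability Omega R) (mu : probability T R)
    {I : eqType} (X : I -> Omega -> T) : Prop :=
  [/\ forall i, measurable_fun setT (X i),
      forall i (A : set T), measurable A -> P (X i @^-1` A) = mu A &
      mutually_independent P X].

End iid.

Section dipnet.
Context {R : realType}.

(* The columns of V : 'M_(n, k) are linearly independent eigenvectors, for the
   k largest eigenvalues counted with multiplicity, of the generalized problem
   A v = lambda B v: they are the first k columns of a full eigenbasis U sorted
   by nonincreasing eigenvalues. No normalization is imposed. *)
Definition leading_eigenvectors {n k} (A B : 'M[R]_n) (V : 'M[R]_(n, k)) :
    Prop :=
  exists (U : 'M[R]_n) (lambda : 'rV[R]_n) (kn : (k <= n)%N),
    [/\ U \in unitmx,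
        A *m U = B *m U *m diag_mx lambda,
        (forall i j : 'I_n, (i <= j)%N -> lambda 0 j <= lambda 0 i) &
        V = colsub (widen_ord kn) U].

Definition jac {n d} (F : 'cV[R]_n -> 'cV[R]_d) (m : 'cV[R]_n) : 'M[R]_(d, n) :=
  \matrix_(k, j) ('D_(delta_mx j 0) F m) k 0.

Definition active_subspace_mx {n d} (mu : probability 'cV[R]_n R)
    (F : 'cV[R]_n -> 'cV[R]_d) : 'M[R]_n :=
  \matrix_(i, j) fine ('E_mu[fun m => ((jac F m)^T *m jac F m) i j])%E.

Definition pod_mx {n d} (mu : probability 'cV[R]_n R)
    (F : 'cV[R]_n -> 'cV[R]_d) : 'M[R]_d :=
  \matrix_(i, j) fine ('E_mu[fun m => (F m *m (F m)^T) i j])%E.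

(* Feedforward networks R^p -> R^q with optional skip connections; a residual
   layer z + W2 s(W1 z + b1) + b2 is
   Skip (Comp (Affine W2 b2) (Comp (Activation s_cont) (Affine W1 b1))).
   The weights are the matrices and vectors of the affine layers. *)
Inductive network : nat -> nat -> Type :=
| Affine p q (A : 'M[R]_(q, p)) (b : 'cV[R]_q) : network p q
| Activation p (s : R -> R) (s_cont : continuous s) : network p p
| Skip p (N : network p p) : network p p
| Comp p q l (N2 : network q l) (N1 : network p q) : network p l.

Fixpoint network_eval p q (N : network p q) : 'cV[R]_p -> 'cV[R]_q :=
  match N in network p q return 'cV[R]_p -> 'cV[R]_q with
  | Affine _ _ A b => fun z => A *m z + b
  | Activation _ s _ => fun z => map_mx s z
  | Skip _ N => fun z => z + network_eval N z
  | Comp _ _ _ N2 N1 => fun z => network_eval N2 (network_eval N1 z)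
  end.

Record dipnet (n d : nat) := DIPNet {
  rM : nat;
  rF : nat;
  proj_in : 'M[R]_(n, rM);
  proj_out : 'M[R]_(d, rF);
  net : network rM rF;
  bias : 'cV[R]_d }.

Definition dipnet_map {n d} (D : dipnet n d) (m : 'cV[R]_n) : 'cV[R]_d :=
  proj_out D *m network_eval (net D) ((proj_in D)^T *m m) + bias D.

Definition dipnet_of {n d} (mu : probability 'cV[R]_n R) (Gpr : 'M[R]_n)
    (F : 'cV[R]_n -> 'cV[R]_d) (D : dipnet n d) : Prop :=
  leading_eigenvectors (active_subspace_mx mu F) (invmx Gpr) (proj_in D) /\
  leading_eigenvectors (pod_mx mu F) 1%:M (proj_out D).

End dipnet.
Arguments dipnet R n d : clear implicits.

Section oed.
Context {R : realType}.

Definition design_mx {r d} (W : 'M[R]_(r, d)) : Prop :=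
  [/\ forall i j, W i j = 0 \/ W i j = 1,
      forall j, \sum_i W i j = 0 \/ \sum_i W i j = 1 &
      forall i, \sum_j W i j = 1].

Definition weighted_sqnorm {r} (G : 'M[R]_r) (z : 'cV[R]_r) : R :=
  (z^T *m invmx G *m z) 0 0.

(* In the following, G is the map (true or surrogate) whose likelihood is
   evaluated. *)
Definition likelihood {n d r} (Gn : 'M[R]_r) (W : 'M[R]_(r, d))
    (G : 'cV[R]_n -> 'cV[R]_d) (y : 'cV[R]_r) (m : 'cV[R]_n) : R :=
  expR (- (2^-1 * weighted_sqnorm Gn (y - W *m G m))).

Definition evidence {n d r} (Gn : 'M[R]_r) (W : 'M[R]_(r, d))
    (G : 'cV[R]_n -> 'cV[R]_d) (nin : nat) (ms : nat -> 'cV[R]_n)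
    (y : 'cV[R]_r) : R :=
  nin%:R^-1 * \sum_(j < nin) likelihood Gn W G y (ms j).

(* The numerator always uses the true map F; the double-loop estimator is the
   case G = F, and the surrogate estimator the case where G is the surrogate. *)
Definition eig_estimator {n d r} (Gn : 'M[R]_r) (W : 'M[R]_(r, d))
    (F G : 'cV[R]_n -> 'cV[R]_d) (nout nin : nat)
    (m : 'I_nout -> 'cV[R]_n) (ms : 'I_nout -> nat -> 'cV[R]_n)
    (y : 'I_nout -> 'cV[R]_r) : R :=
  nout%:R^-1 * \sum_(i < nout)
    ln (likelihood Gn W F (y i) (m i) / evidence Gn W G nin (ms i) (y i)).

End oed.

(* Main.v *)
Require Import Defs.
From HB Require Import structures.
From mathcomp Require Import all_boot all_order all_algebra.
From mathcomp Require Import all_classical all_reals all_analysis.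
From mathcomp Require Import measurable_realfun ring lra.
Import Order.TTheory GRing.Theory Num.Theory.
Import numFieldNormedType.Exports.
Local Open Scope classical_set_scope.
Local Open Scope ring_scope.

Set Implicit Arguments.
Unset Strict Implicit.
Unset Printing Implicit Defensive.

(** The Gaussian kernel [exp (- t ^ 2 / 2)] is 1-Lipschitz in [t >= 0], and [t] here is
    the noise-weighted seminorm of a residual. The likelihoods of a sample [x] under the
    true map and under the surrogate therefore differ by at most
    [sqrt (s * |F x - Ft x| ^ 2)], where [s] is [sensitivity], whatever the data
    ([likelihood_dist_sqr]). Since
    the square of a mean is at most the mean of the squares, the squared difference of
    the evidences is bounded by the empirical mean of [min 1 (s * |F - Ft| ^ 2)]. This
    is a bounded function of i.i.d. samples whose expectation is at most [s * eps ^ 2],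
    so almost surely its empirical mean is eventually at most [4 * s * eps ^ 2], and the
    evidences differ by at most [2 * sqrt s * eps] ([evidence_dist_le]).

    The data [y_i] need not be independent of the inner samples, so the law of large
    numbers is only used for functions that do not involve [y_i]. As constant factors
    are harmless, the version needed is modest ([iid_sum_bounds]): for [h] with values
    in [0, 1], the empirical mean is almost surely eventually between a quarter and four
    times the expectation. Chebyshev's inequality and Borel-Cantelli give this along
    powers of 2, and monotonicity of partial sums fills the gaps.

    The information gain involves logarithms of evidences, so the evidences have to be
    bounded below. The parallelogram law separates data from sample
    ([likelihood_ge]), and the empirical mean of [exp (- s * |G| ^ 2)] is eventually at
    least a quarter of its expectation, which by Jensen's inequality
    ([expectation_expRN_ge]) is at least [exp (- s * k)], with [k] the second moment of
    [G]. Applying this to the true map and to the surrogate yields a positive floor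
    depending only on [y_i] and [k], above which the logarithm is Lipschitz
    ([eig_estimator_dist_le]). Surrogates are measurable because networks with
    continuous activations are continuous. *)

(** * Moments of functions of i.i.d. samples *)

Section iid_moments.
Context {R : realType} {d1 d2 : measure_display}
  {Omega : measurableType d1} {T : measurableType d2}.
Context (P : probability Omega R) (mu : probability T R) {I : eqType}.
Context (X : I -> Omega -> T) (iidX : iid_samples P mu X).
Context (h : T -> R) (mh : measurable_fun setT h) (h0 : forall x, 0 <= h x).

Lemma iid_expectation i : ('E_P[h \o X i] = 'E_mu[h])%E.
Proof.
have [mX lawX _] := iidX.
pose Xi : {mfun Omega >-> T} := HB.pack (X i) (isMeasurableFun.Build _ _ _ _ _ (mX i)).
rewrite unlock.
transitivity (\int[distribution P Xi]_x (h x)%:E)%E.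
  by rewrite ge0_integral_distribution//; exact/measurable_EFinP.
by apply: eq_measure_integral => A mA _; exact: lawX.
Qed.

Lemma iid_pair_law i j A B : i != j -> measurable A -> measurable B ->
  P ((X i @^-1` A) `&` (X j @^-1` B)) = (mu A * mu B)%E.
Proof.
move=> ij mA mB; have [mX lawX indX] := iidX.
have := indX [:: i; j] (fun l => if l == i then A else B).
rewrite !big_cons !big_nil setIT mule1 eqxx eq_sym (negbTE ij) -(lawX i)// -(lawX j)//.
by apply=> [|l]; [rewrite /= inE ij|case: ifP].
Qed.

(** The joint law of two samples agrees with [mu \x mu] on rectangles, hence
    everywhere, and Tonelli's theorem splits the double integral. *)
Lemma iid_expectationM i j : i != j ->
  ('E_P[(h \o X i)%R \* (h \o X j)%R] = 'E_mu[h] * 'E_mu[h])%E.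
Proof.
move=> ij; have [mX lawX indX] := iidX.
have mXij : measurable_fun setT (fun w => (X i w, X j w)).
  exact: measurable_fun_pair.
pose Xij : {mfun Omega >-> (T * T)%type} :=
    HB.pack (fun w => (X i w, X j w)) (isMeasurableFun.Build _ _ _ _ _ mXij).
have mh1 : measurable_fun setT (fun z : T * T => h z.1).
  exact: measurableT_comp.
have mh2 : measurable_fun setT (fun z : T * T => h z.2).
  exact: measurableT_comp.
rewrite unlock.
transitivity (\int[distribution P Xij]_z (h z.1 * h z.2)%:E)%E.
  rewrite ge0_integral_distribution//.
    by apply/measurable_EFinP; exact: measurable_funM.
  by move=> x; rewrite lee_fin mulr_ge0.
transitivity (\int[mu \x mu]_z (h z.1 * h z.2)%:E)%E.
  apply: eq_measure_integral => A mA _.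
  apply/esym/(product_measure_unique (m' := distribution P Xij)) => //.
  by move=> B C mB mC; exact: iid_pair_law.
rewrite fubini_tonelli1/=; last 2 first.
- by apply/measurable_EFinP; exact: measurable_funM.
- by move=> x; rewrite lee_fin mulr_ge0.
rewrite /fubini_F /=.
under eq_integral.
  move=> x _; under eq_integral do rewrite EFinM.
  rewrite ge0_integralZl_EFin//; last 2 first.
  - by move=> y _; rewrite lee_fin.
  - exact/measurable_EFinP.
  over.
rewrite ge0_integralZr//.
- exact/measurable_EFinP.
- by move=> x _; rewrite lee_fin.
- by apply: integral_ge0 => x _; rewrite lee_fin.
Qed.

End iid_moments.

Section bounded_functions.
Context {R : realType} {d : measure_display} {T : measurableType d}.
Context (P : probability T R).

Lemma Lfun2_bounded (f : T -> R) : measurable_fun setT f ->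
  (forall x, 0 <= f x <= 1) -> f \in Lfun P 2%:E.
Proof.
move=> mf f01; rewrite inE; apply/andP; split; rewrite inE//= /finite_norm.
rewrite unlock /Lnorm poweR_lty//.
apply: (@le_lt_trans _ _ (\int[P]_x (cst 1%:E x))%E); last first.
  by rewrite integral_cst//= mul1e probability_setT ltry.
apply: ge0_le_integral => //=.
- apply/measurable_EFinP.
  apply: (@measurableT_comp _ _ _ _ _ _ (fun x : R => x `^ 2)%R) => //.
  exact: measurableT_comp.
- move=> x _; have /andP[fx0 fx1] := f01 x.
  by rewrite lee_fin powR_mulrn// ger0_norm// exprn_ile1.
Qed.

End bounded_functions.

(** * A law of large numbers up to a constant factor *)

Section law_of_large_numbers.
Context {R : realType} {d1 d2 : measure_display}
  {Omega : measurableType d1} {T : measurableType d2}.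
Context (P : probability Omega R) (mu : probability T R).
Context (X : nat -> Omega -> T) (iidX : iid_samples P mu X).
Context (h : T -> R) (mh : measurable_fun setT h) (h01 : forall x, 0 <= h x <= 1).

Let h0 x : 0 <= h x. Proof. by have /andP[] := h01 x. Qed.
Let Y j : Omega -> R := h \o X j.
Let S n : Omega -> R := fun w => \sum_(j < n) h (X j w).

Let mY j : measurable_fun setT (Y j).
Proof. by have [mX _ _] := iidX; apply: measurableT_comp. Qed.

Let mS n : measurable_fun setT (S n).
Proof. by apply: measurable_sum => j; exact: mY. Qed.

Let S0 : S 0 = cst 0.
Proof. by apply/funext => w; rewrite /S big_ord0. Qed.

Let SS n : S n.+1 = S n \+ Y n.
Proof. by apply/funext => w; rewrite /S big_ord_recr. Qed.

Let Y2 j : Y j \in Lfun P 2%:E.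
Proof. by apply: Lfun2_bounded => // w; exact: h01. Qed.

Let S2 n : S n \in Lfun P 2%:E.
Proof.
by elim: n => [|n IHn]; [rewrite S0 Lfun_cst|rewrite SS rpredD// lee1n].
Qed.

Let Pfin : P setT \is a fin_num. Proof. exact: fin_num_measure. Qed.
Let Y1 j := Lfun_subset12 Pfin (Y2 j).
Let S1 n := Lfun_subset12 Pfin (S2 n).

Local Notation p := (fine ('E_mu[h])%E).

Let EhE : ('E_mu[h] = p%:E)%E.
Proof.
rewrite fineK// expectation_fin_num// Lfun_subset12//.
  exact: fin_num_measure.
exact: Lfun2_bounded.
Qed.

Let ES n : ('E_P[S n] = (n%:R * p)%:E)%E.
Proof.
elim: n => [|n IHn]; first by rewrite S0 expectation_cst mul0r.
by rewrite SS expectationD// IHn (iid_expectation iidX)// EhE -EFinD -natr1 mulrDl mul1r.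
Qed.

Let covSY n k : (k <= n)%N -> covariance P (S k) (Y n) = 0%E.
Proof.
elim: k => [|k IHk] kn; first by rewrite S0 covariance_cst_l.
rewrite SS covarianceDl// IHk ?(ltnW kn)// add0e covarianceE//; last first.
  exact: Lfun2_mul_Lfun1.
have -> : ('E_P[(Y k * Y n)%R] = 'E_mu[h] * 'E_mu[h])%E.
  by apply: (iid_expectationM iidX) => //; rewrite ltn_eqF.
by rewrite !(iid_expectation iidX)// EhE -EFinM -EFinB subrr.
Qed.

(* Pairwise independence removes the cross terms, so the variance grows only
   linearly; this makes the Chebyshev bounds below summable over powers of 2. *)
Let VS n : ('V_P[S n] <= n%:R%:E)%E.
Proof.
elim: n => [|n IHn]; first by rewrite S0 variance_cst.
rewrite SS varianceD// covSY// mule0 adde0 -natr1 EFinD leeD//.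
rewrite varianceE// (iid_expectation iidX)// EhE.
have EY : ('E_P[Y n ^+ 2] <= 1)%E.
  rewrite -[leRHS](expectation_cst P 1); apply: expectation_le => //.
  - exact: (measurable_funM (mY n) (mY n)).
  - by move=> x; exact: sqr_ge0.
  - by apply: aeW => x; have /andP[? ?] := h01 (X n x); apply: mulr_ile1.
by rewrite (le_trans _ EY)// -EFin_expe leeBlDr// leeDl// lee_fin sqr_ge0.
Qed.


Let deviation_tail k : 0 < p ->
  (P [set w | (p / 2 * (2 ^ k)%:R <= `|S (2 ^ k)%N w - (2 ^ k)%:R * p|)%R]
    <= (8 / p ^+ 2 / (2 ^ k.+1)%:R)%:E)%E.
Proof.
move=> p0.
pose Sk : {RV P >-> R} := HB.pack (S (2 ^ k)%N)
  (isMeasurableFun.Build _ _ _ _ _ (mS (2 ^ k)%N)).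
have e0 : 0 < p / 2 * (2 ^ k)%:R.
  by rewrite mulr_gt0 ?divr_gt0// ltr0n expn_gt0.
have := chebyshev Sk e0; rewrite ES/= => /le_trans; apply.
apply: (@le_trans _ _ (((p / 2 * (2 ^ k)%:R) ^- 2)%:E * ((2 ^ k)%:R)%:E)%E).
  by rewrite lee_wpmul2l// lee_fin invr_ge0 sqr_ge0.
rewrite -EFinM lee_fin expnS natrM.
have k0 : (2 ^ k)%:R != 0 :> R by rewrite pnatr_eq0 -lt0n expn_gt0.
by rewrite le_eqVlt; apply/orP; left; apply/eqP; field; rewrite k0 gt_eqF.
Qed.

(* Borel-Cantelli: the tail bounds are the terms of a convergent geometric
   series, so almost surely only finitely many deviations occur. *)
Let dyadic_sums : 0 < p -> {ae P, forall w, \forall k \near \oo,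
  p / 2 * (2 ^ k)%:R <= S (2 ^ k)%N w <= 2 * p * (2 ^ k)%:R}.
Proof.
move=> p0.
pose A k := [set w | p / 2 * (2 ^ k)%:R <= `|S (2 ^ k)%N w - (2 ^ k)%:R * p| ].
have mA k : measurable (A k).
  rewrite /A -[X in measurable X]setTI; apply: measurable_fun_le => //.
  apply: measurableT_comp => //; exact: measurable_funB.
have PA : P (lim_sup_set A) = 0%E.
  apply: lim_sup_set_cvg0 => //.
  apply: (@le_lt_trans _ _ (8 / p ^+ 2)%:E); last exact: ltry.
  apply: (le_trans _ (@epsilon_trick0 R (8 / p ^+ 2) xpredT _)).
    by apply: lee_nneseries => // k _; exact: deviation_tail.
  by rewrite divr_ge0// sqr_ge0.
exists (lim_sup_set A); split => //.
  by apply: bigcap_measurable => // k _; exact: bigcup_measurable.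
move=> w /=; apply: contra_notP => /existsNP[N].
move/not_implyP => [_ NA].
exists N => // k /= Nk.
have kA : ~ A k w by move=> kA; apply: NA; exists k.
have : `|S (2 ^ k)%N w - (2 ^ k)%:R * p| < p / 2 * (2 ^ k)%:R.
  by rewrite ltNge; apply/negP.
by rewrite ltr_norml => /andP[? ?]; apply/andP; split; lra.
Qed.

Let S_nd w m n : (m <= n)%N -> S m w <= S n w.
Proof.
move=> mn; rewrite -(subnKC mn) /S big_split_ord/= lerDl.
exact: sumr_ge0.
Qed.

(** For [p > 0] the partial sums are controlled along [n = 2 ^ k]; since [h >= 0]
    they are nondecreasing, so for [n] between two consecutive powers of 2 only
    a factor 2 is lost. For [p = 0] the function vanishes almost surely at every
    sample. The bounds are purely multiplicative, without additive error, and it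
    is this that lets the final estimates hold for [eps = 0] too. *)
Lemma iid_sum_bounds : {ae P, forall w, \forall n \near \oo,
  p / 4 * n%:R <= \sum_(j < n) h (X j w) <= 4 * p * n%:R}.
Proof.
have p_ge0 : 0 <= p by rewrite fine_ge0// expectation_ge0.
have [p0|p0] := eqVneq p 0.
  have Y0 j : {ae P, forall w, h (X j w) = 0}.
    have /(ae_eq_integral_abs P measurableT) : measurable_fun setT (EFin \o Y j).
      exact/measurable_EFinP.
    move=> [+ _].
    have -> : (\int[P]_w `|(EFin \o Y j) w| = 0)%E.
      have := iid_expectation iidX mh h0 j; rewrite EhE p0 unlock => hj0.
      rewrite -[RHS]hj0.
      by apply: eq_integral => w _ /=; rewrite ger0_norm// h0.
    by move=> /(_ erefl); apply: filterS => w /(_ I) [].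
  have : {ae P, forall w j, h (X j w) = 0} by exact: ae_foralln.
  apply: filterS => w hw; near=> n.
  by rewrite big1 ?p0 ?mul0r ?mulr0 ?mul0r ?lexx.
have {p0}p0 : 0 < p by rewrite lt0r p0.
apply: filterS (dyadic_sums p0) => w [N _ NS].
exists (2 ^ N)%N => // n /= Nn.
have n0 : (0 < n)%N by rewrite (leq_trans _ Nn)// expn_gt0.
set k := trunc_log 2 n.
have /andP[kn nk] : (2 ^ k <= n < 2 ^ k.+1)%N by exact: trunc_log_bounds.
have Nk : (N <= k)%N by rewrite trunc_log_max.
have /andP[lo _] := NS k Nk.
have /andP[_ hi] := NS k.+1 (leqW Nk).
have := S_nd w kn; have := S_nd w (ltnW nk); rewrite -/(S n w).
move: kn nk; rewrite -(ler_nat R) -(ltr_nat R) => kn nk nS Sn.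
have k2 : (2 ^ k.+1)%:R = 2 * (2 ^ k)%:R :> R by rewrite expnS natrM.
rewrite k2 in hi nk.
have pn := ler_wpM2l (ltW p0) (ltW nk).
have pk := ler_wpM2l (ltW p0) kn.
by apply/andP; split; lra.
Unshelve. all: by end_near. Qed.

End law_of_large_numbers.

(** * Real inequalities *)

Section real_inequalities.
Context {R : realType}.
Implicit Types a b : R.

(** With [b = a + d] and [0 <= d <= 1], the difference is
    [E * (1 - exp (- d (a + d / 2)))] with [E = exp (- a ^ 2 / 2)], hence at most
    [d * (E * (a + d / 2))]; and [a + d / 2 <= 1 + a ^ 2 / 2 <= 1 / E]. For
    [d >= 1] the values of the kernel lie in [0, 1]. *)
Lemma gauss_kernel_lipschitz a b : 0 <= a -> 0 <= b ->
  `|expR (- (2^-1 * a ^+ 2)) - expR (- (2^-1 * b ^+ 2))| <= `|a - b|.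
Proof.
wlog ab : a b / a <= b => [th a0 b0|a0 b0].
  have [ab|/ltW ba] := leP a b; first exact: th.
  by rewrite distrC (distrC a); exact: th.
have ea1 : expR (- (2^-1 * a ^+ 2)) <= 1.
  by rewrite expR_le1 oppr_le0 mulr_ge0// ?sqr_ge0// invr_ge0.
have eb0 := expR_gt0 (- (2^-1 * b ^+ 2)).
have eba : expR (- (2^-1 * b ^+ 2)) <= expR (- (2^-1 * a ^+ 2)).
  by rewrite ler_expR lerN2 ler_pM2l ?invr_gt0// ler_sqr.
rewrite ger0_norm ?subr_ge0// ler0_norm ?subr_le0// opprB.
have [ba1|/ltW ba1] := leP 1 (b - a); first by lra.
set d := b - a in ba1 *; have d0 : 0 <= d by rewrite subr_ge0.
have bE : b = a + d by rewrite /d; ring.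
set E := expR (- (2^-1 * a ^+ 2)) in ea1 eba *.
have ebE : expR (- (2^-1 * b ^+ 2)) = E * expR (- (d * (a + d / 2))).
  by rewrite -expRD; congr expR; rewrite bE; field.
have E0 : 0 < E by exact: expR_gt0.
have h1 : 1 - d * (a + d / 2) <= expR (- (d * (a + d / 2))).
  exact: expR_ge1Dx.
have h2 : E * (a + d / 2) <= 1.
  have EK : E * expR (2^-1 * a ^+ 2) = 1 by rewrite -expRD addNr expR0.
  have h3 := expR_ge1Dx (2^-1 * a ^+ 2).
  rewrite -[leRHS]EK ler_pM2l//; apply: le_trans h3.
  have := sqr_ge0 (a - 1); have -> : (a - 1) ^+ 2 = a ^+ 2 - 2 * a + 1 by ring.
  lra.
rewrite ebE.
have h3 := ler_wpM2l (ltW E0) h1.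
have h4 := ler_wpM2l d0 h2.
nra.
Qed.

Lemma ln_dist_le a b : 0 < a -> 0 < b ->
  `|ln a - ln b| <= `|a - b| * (a^-1 + b^-1).
Proof.
wlog ab : a b / a <= b => [th a0 b0|a0 b0].
  have [ab|/ltW ba] := leP a b; first exact: th.
  by rewrite distrC (distrC a) (addrC a^-1); exact: th.
have lab : ln a <= ln b by rewrite ler_ln.
rewrite ler0_norm ?subr_le0// ler0_norm ?subr_le0// !opprB.
have /le_ln1Dx : -1 < b / a - 1 by rewrite ltrBrDr addNr divr_gt0.
rewrite addrC subrK ln_div// => /le_trans; apply.
have -> : b / a - 1 = (b - a) * a^-1 by field; rewrite gt_eqF.
by rewrite ler_wpM2l ?subr_ge0// lerDl invr_ge0 ltW.
Qed.

(** The variance of the finite family [a] is nonnegative. *)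
Lemma sqr_mean_le n (a : 'I_n -> R) :
  (n%:R^-1 * \sum_j a j) ^+ 2 <= n%:R^-1 * \sum_j a j ^+ 2.
Proof.
case: n a => [|n] a; first by rewrite invr0 !mul0r expr0n.
set m := (n.+1)%:R^-1 * \sum_j a j.
have : 0 <= \sum_j (a j - m) ^+ 2 by apply: sumr_ge0 => j _; exact: sqr_ge0.
have -> : \sum_j (a j - m) ^+ 2 = \sum_j a j ^+ 2 - n.+1%:R * m ^+ 2.
  have sumE : \sum_j a j = n.+1%:R * m by rewrite /m mulrA divff ?mul1r ?pnatr_eq0.
  transitivity (\sum_j (a j ^+ 2 + (- (2 * m)) * a j + m ^+ 2)).
    by apply: eq_bigr => j _; ring.
  rewrite !big_split/= -mulr_sumr sumE sumr_const card_ord -[m ^+ 2 *+ _]mulr_natl.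
  by ring.
by rewrite subr_ge0 ler_pdivlMl ?ltr0n.
Qed.

End real_inequalities.

(** * The noise-weighted quadratic form *)

Section quadratic_forms.
Context {R : realType}.

Lemma sqnorm_ge0 n (z : 'cV[R]_n) : 0 <= sqnorm z.
Proof. by apply: sumr_ge0 => i _; exact: sqr_ge0. Qed.

Definition entry_sum m n (M : 'M[R]_(m, n)) : R := \sum_i \sum_j `|M i j|.

Lemma entry_sum_ge0 m n (M : 'M[R]_(m, n)) : 0 <= entry_sum M.
Proof. by apply: sumr_ge0 => i _; exact: sumr_ge0. Qed.

Lemma quad_form_le n (M : 'M[R]_n) (z : 'cV[R]_n) :
  (z^T *m M *m z) 0 0 <= entry_sum M * sqnorm z.
Proof.
have zz i j : z i 0 * z j 0 <= sqnorm z /\ - (z i 0 * z j 0) <= sqnorm z.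
  have [->|ij] := eqVneq i j.
    rewrite /sqnorm (bigD1 j)//= -expr2.
    have : 0 <= \sum_(k | k != j) z k 0 ^+ 2 by apply: sumr_ge0 => k _; exact: sqr_ge0.
    by have := sqr_ge0 (z j 0); split; lra.
  rewrite /sqnorm (bigD1 i)//= (bigD1 j)/=; last by rewrite eq_sym.
  have : 0 <= \sum_(k | (k != i) && (k != j)) z k 0 ^+ 2.
    by apply: sumr_ge0 => k _; exact: sqr_ge0.
  have := sqr_ge0 (z i 0 - z j 0); have := sqr_ge0 (z i 0 + z j 0).
  by rewrite sqrrB sqrrD; split; nra.
rewrite mxE /entry_sum exchange_big mulr_suml; apply: ler_sum => j _.
rewrite mxE !mulr_suml; apply: ler_sum => i _; rewrite mxE.
have [h1 h2] := zz i j.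
have [M0|M0] := leP 0 (M i j).
  rewrite (_ : _ * _ * _ = M i j * (z i 0 * z j 0)); last by ring.
  by rewrite (ger0_norm M0) ler_wpM2l.
rewrite (_ : _ * _ * _ = - M i j * - (z i 0 * z j 0)); last by ring.
by rewrite (ltr0_norm M0) ler_wpM2l// oppr_ge0 ltW.
Qed.

Section weighted.
Context r (G : 'M[R]_r) (covG : covariance_mx G) (uG : G \in unitmx).
Implicit Types u v : 'cV[R]_r.
Local Notation q := (weighted_sqnorm G).

Definition weighted_dot u v : R := (u^T *m invmx G *m v) 0 0.
Local Notation b := weighted_dot.

Lemma weighted_sqnorm_ge0 u : 0 <= weighted_sqnorm G u.
Proof.
have [sG pG] := covG.
(* With x = G^-1 u, the form u^T G^-1 u is x^T G x. *)
rewrite /weighted_sqnorm; have := pG (invmx G *m u).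
by rewrite trmx_mul trmx_inv sG -!mulmxA mulKVmx// mulmxA.
Qed.


Lemma weighted_sqnormD u v t :
  q (u + t *: v) = q u + 2 * t * b u v + t ^+ 2 * q v.
Proof.
have bC : b v u = b u v.
  have [sG _] := covG; rewrite /weighted_dot.
  transitivity ((v^T *m invmx G *m u)^T 0 0); first by rewrite [RHS]mxE.
  by rewrite !trmx_mul trmxK trmx_inv sG mulmxA.
rewrite /weighted_sqnorm; move: bC; rewrite /weighted_dot.
have -> : (u + t *: v)^T = u^T + t *: v^T by rewrite linearD linearZ.
rewrite !mulmxDl !mulmxDr -!scalemxAl -!scalemxAr.
move: (u^T *m _ *m u) (u^T *m _ *m v) (v^T *m _ *m u) (v^T *m _ *m v).
by move=> uu uv vu vv vuE; rewrite !mxE vuE; ring.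
Qed.

(** Cauchy-Schwarz: [t |-> q (u + t v)] is nonnegative, in particular at its
    minimizer [- b u v / q v], or, when [q v = 0] and it is affine, at a point where
    it would be [-1] if its slope did not vanish. *)
Lemma weighted_sqnorm_CS u v : b u v ^+ 2 <= q u * q v.
Proof.
have H t : 0 <= q u + 2 * t * b u v + t ^+ 2 * q v.
  by rewrite -weighted_sqnormD weighted_sqnorm_ge0.
have qu := weighted_sqnorm_ge0 u; have qv := weighted_sqnorm_ge0 v.
have [v0|v0] := eqVneq (q v) 0.
  have [->|b0] := eqVneq (b u v) 0; first by rewrite expr0n/= mulr_ge0.
  have := H (- (q u + 1) / (2 * b u v)); rewrite v0 mulr0 addr0.
  rewrite (_ : _ + _ = -1) ?ler0N1//.
  by field.
have := H (- b u v / q v).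
rewrite (_ : _ + _ + _ = (q u * q v - b u v ^+ 2) / q v); last by field.
by rewrite pmulr_lge0 ?invr_gt0 ?lt0r ?v0// subr_ge0.
Qed.

(** The reverse triangle inequality for the seminorm [sqrt q]. *)
Lemma sqrt_weighted_sqnorm_dist u v :
  (Num.sqrt (q u) - Num.sqrt (q v)) ^+ 2 <= q (u - v).
Proof.
have -> : q (u - v) = q u - 2 * b u v + q v.
  by rewrite -[- v]scaleN1r weighted_sqnormD; ring.
have qu := weighted_sqnorm_ge0 u; have qv := weighted_sqnorm_ge0 v.
rewrite sqrrB !sqr_sqrtr//.
suff : b u v <= Num.sqrt (q u) * Num.sqrt (q v) by lra.
rewrite (le_trans (ler_norm _))// -sqrtrM// -sqrtr_sqr ler_wsqrtr//.
exact: weighted_sqnorm_CS.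
Qed.

Lemma weighted_sqnormB_le u v : 2^-1 * q (u - v) <= q u + q v.
Proof.
have := weighted_sqnorm_ge0 (u + 1 *: v); rewrite weighted_sqnormD.
have -> : q (u - v) = q u - 2 * b u v + q v.
  by rewrite -[- v]scaleN1r weighted_sqnormD; ring.
lra.
Qed.

End weighted.
End quadratic_forms.

(** * Bounds on the likelihood *)

Section likelihood_bounds.
Context {R : realType} (n d r : nat) (Gn : 'M[R]_r) (W : 'M[R]_(r, d)).
Context (covG : covariance_mx Gn) (uG : Gn \in unitmx).
Implicit Types (F G : 'cV[R]_n -> 'cV[R]_d) (y : 'cV[R]_r) (x : 'cV[R]_n).

(** A bound on the largest eigenvalue of [W^T Gn^-1 W], that is, on the squared
    operator norm of [W] from the Euclidean norm to the noise-weighted one. *)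
Definition sensitivity : R := entry_sum (W^T *m invmx Gn *m W).

Lemma sensitivity_ge0 : 0 <= sensitivity.
Proof. exact: entry_sum_ge0. Qed.

Lemma weighted_sqnorm_design_le (z : 'cV[R]_d) :
  weighted_sqnorm Gn (W *m z) <= sensitivity * sqnorm z.
Proof.
have := quad_form_le (W^T *m invmx Gn *m W) z.
by rewrite /weighted_sqnorm trmx_mul !mulmxA.
Qed.

(** Truncation at 1 costs nothing, as likelihoods lie in [0, 1], and makes the right
    side a bounded function of the sample; moreover it does not involve the data [y],
    which may depend on the sample. *)
Lemma likelihood_dist_sqr F G y x :
  (likelihood Gn W F y x - likelihood Gn W G y x) ^+ 2 <=
  Num.min 1 (sensitivity * sqnorm (F x - G x)).
Proof.
set u := y - W *m F x; set v := y - W *m G x.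
have qu := weighted_sqnorm_ge0 covG uG u.
have qv := weighted_sqnorm_ge0 covG uG v.
have := gauss_kernel_lipschitz (sqrtr_ge0 (weighted_sqnorm Gn u))
  (sqrtr_ge0 (weighted_sqnorm Gn v)).
rewrite !sqr_sqrtr// -/(likelihood Gn W F y x) -/(likelihood Gn W G y x) => lip.
rewrite le_min; apply/andP; split.
  have l01 H : 0 <= likelihood Gn W H y x <= 1.
    by rewrite expR_ge0 expR_le1 oppr_le0 mulr_ge0 ?invr_ge0// weighted_sqnorm_ge0.
  have := l01 F; have := l01 G => /andP[? ?] /andP[? ?].
  by rewrite -real_normK ?num_real// expr_le1// ler_norml; apply/andP; split; lra.
apply: le_trans (weighted_sqnorm_design_le _).
have -> : W *m (F x - G x) = v - u.
  by rewrite mulmxBr /u /v opprB [RHS]addrC addrA subrK.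
apply: le_trans (sqrt_weighted_sqnorm_dist covG uG v u).
rewrite -[leLHS]real_normK ?num_real// -[leRHS]real_normK ?num_real//.
by rewrite ler_sqr ?nnegrE// (distrC (Num.sqrt _)).
Qed.

(** The data and the sample are separated, so that the law of large numbers is only
    applied to a function of the sample. *)
Lemma likelihood_ge G y x :
  expR (- weighted_sqnorm Gn y) * expR (- (sensitivity * sqnorm (G x))) <=
  likelihood Gn W G y x.
Proof.
rewrite -expRD ler_expR -opprD lerN2.
apply: le_trans (weighted_sqnormB_le covG uG _ _) _.
by rewrite lerD2l weighted_sqnorm_design_le.
Qed.

End likelihood_bounds.

(** * Measurability of surrogates *)

Section surrogate_measurability.
Context {R : realType}.

Lemma continuous_measurable_fun_mx m n p q (f : 'M[R]_(m, n) -> 'M[R]_(p, q)) :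
  continuous f -> measurable_fun setT f.
Proof.
move=> /continuousP cf.
pose G := [set A : set 'M[R]_(p, q) | open A].
apply: (measurability G) => // _ [A oA <-]; rewrite setTI.
by apply: sub_sigma_algebra; exact: cf.
Qed.

Lemma measurable_coord m n i j :
  measurable_fun setT (fun M : 'M[R]_(m, n) => M i j).
Proof.
apply: (measurability _ (RGenOpens.measurableE R)) => _ [_ [a [b ->]] <-].
rewrite setTI; apply: sub_sigma_algebra.
have /continuousP := @coord_continuous R m n i j; apply.
exact: interval_open.
Qed.

Lemma continuous_mx (T : topologicalType) p q (f : T -> 'M[R]_(p, q)) :
  (forall i j, continuous (fun x => f x i j)) -> continuous f.
Proof.
move=> cf x A [B Bf BA].
have : \forall y \near x, forall i j, B i j (f y i j).
  by apply: filter_forall => i; apply: filter_forall => j; apply: cf; exact: Bf.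
by apply: filterS => y By; exact: BA.
Qed.

Lemma mulmx_continuous m p q (A : 'M[R]_(p, m)) :
  continuous (fun z : 'M[R]_(m, q) => A *m z).
Proof.
apply: continuous_mx => i j.
under eq_fun do rewrite mxE.
apply: continuous_big => [x|k _ z]; first exact: add_continuous.
apply: (@continuousM _ _ (fun=> A i k) (fun z : 'M[R]_(m, q) => z k j) z);
  [exact: cst_continuous|exact: coord_continuous].
Qed.

Lemma addmx_continuous (T : topologicalType) p q (f g : T -> 'M[R]_(p, q)) :
  continuous f -> continuous g -> continuous (fun x => f x + g x).
Proof.
move=> cf cg; apply: continuous_mx => i j; under eq_fun do rewrite mxE.
have coord (h : T -> 'M[R]_(p, q)) : continuous h -> continuous (fun x => h x i j).
  move=> ch x.
  apply: (@continuous_comp _ _ _ h (fun M : 'M[R]_(p, q) => M i j)).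
    exact: ch.
  exact: coord_continuous.
by move=> x; apply: (@continuousD _ _ _ (fun x => f x i j) (fun x => g x i j) x);
  exact: coord.
Qed.

Lemma network_eval_continuous p q (N : network (R := R) p q) :
  continuous (network_eval N).
Proof.
elim: N => {p q} [p q A b|p s cs|p N cN|p q l N2 c2 N1 c1] z /=.
- move: z; apply: addmx_continuous; first exact: mulmx_continuous.
  exact: cst_continuous.
- move: z; apply: continuous_mx => i j z.
  rewrite (_ : (fun x => _) = s \o (fun x : 'cV[R]_p => x i j)).
    by apply: continuous_comp; [exact: coord_continuous|exact: cs].
  by apply/funext => x /=; rewrite mxE.
- by move: z; apply: addmx_continuous => // z; exact: cvg_id.
- by apply: (@continuous_comp _ _ _ _ (network_eval N2)); [exact: c1|exact: c2].
Qed.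

Lemma dipnet_map_continuous n d (D : dipnet R n d) : continuous (dipnet_map D).
Proof.
apply: addmx_continuous; last exact: cst_continuous.
move=> x; apply: (@continuous_comp _ _ _ (fun x => network_eval (net D) ((proj_in D)^T *m x))
  (fun z => proj_out D *m z)); last exact: mulmx_continuous.
apply: (@continuous_comp _ _ _ (fun x => (proj_in D)^T *m x)).
  exact: mulmx_continuous.
exact: network_eval_continuous.
Qed.

Lemma measurable_sqnorm d0 (T : measurableType d0) n (f : T -> 'cV[R]_n) :
  measurable_fun setT f -> measurable_fun setT (fun x => sqnorm (f x)).
Proof.
move=> mf; rewrite /sqnorm; apply: measurable_sum => i.
apply: measurable_funX; exact: (measurableT_comp (measurable_coord i 0)).
Qed.

(** Proved coordinatewise, which avoids comparing the Borel sets of a product of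
    matrix spaces with the product of their Borel sets. *)
Lemma measurable_sqnormB d0 (T : measurableType d0) n (f g : T -> 'cV[R]_n) :
  measurable_fun setT f -> measurable_fun setT g ->
  measurable_fun setT (fun x => sqnorm (f x - g x)).
Proof.
move=> mf mg; rewrite /sqnorm; apply: measurable_sum => i.
apply: measurable_funX; under eq_fun do rewrite !mxE.
apply: measurable_funB.
  exact: (measurableT_comp (measurable_coord i 0)).
exact: (measurableT_comp (measurable_coord i 0)).
Qed.

End surrogate_measurability.

(** * Bounds on expectations *)

Section expectation_bounds.
Context {R : realType} {d : measure_display} {T : measurableType d}.
Context (mu : probability T R) (f : T -> R) (c : R).
Context (mf : measurable_fun setT f) (f0 : forall x, 0 <= f x) (c0 : 0 <= c).

Lemma expectation_min1_le e : ('E_mu[f] <= e%:E)%E ->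
  fine ('E_mu[fun x => (Num.min 1 (c * f x))%R])%E <= c * e.
Proof.
move=> fe.
have mcf : measurable_fun setT (fun x => c * f x) by exact: measurable_funM.
have cf0 x : 0 <= c * f x by rewrite mulr_ge0.
have Ecf : ('E_mu[fun x => (c * f x)%R] <= (c * e)%:E)%E.
  rewrite unlock; under eq_integral do rewrite EFinM.
  rewrite ge0_integralZl_EFin//; [|by move=> x _; rewrite lee_fin|exact/measurable_EFinP].
  by rewrite EFinM lee_wpmul2l// -[leLHS]/(\int[mu]_x _)%E; move: fe; rewrite unlock.
have Emin : ('E_mu[fun x => (Num.min 1 (c * f x))%R] <= (c * e)%:E)%E.
  apply: le_trans Ecf; apply: expectation_le => //.
  - exact: measurable_minr.
  - by move=> x; rewrite le_min ler01 cf0.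
  - by apply: aeW => x; rewrite ge_min lexx orbT.
have E0 : (0 <= 'E_mu[fun x => (Num.min 1 (c * f x))%R])%E.
  by apply: expectation_ge0 => x; rewrite le_min ler01 cf0.
by rewrite -lee_fin fineK// ge0_fin_numE// (le_lt_trans Emin)// ltry.
Qed.

(** Jensen's inequality for the convex function [t |-> exp (- c t)], obtained by
    integrating its tangent line at the mean [k] of [f]. *)
Lemma expectation_expRN_ge : ('E_mu[f] < +oo)%E ->
  expR (- (c * fine ('E_mu[f])%E)) <= fine ('E_mu[fun x => (expR (- (c * f x)))%R])%E.
Proof.
move=> Efoo; set k := fine _.
have EfE : ('E_mu[f] = k%:E)%E.
  by rewrite fineK// ge0_fin_numE// expectation_ge0.
have f1 : f \in Lfun mu 1.
  apply/Lfun1_integrable/integrableP; split; first exact/measurable_EFinP.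
  move: Efoo; rewrite unlock; apply: le_lt_trans.
  by under eq_integral do rewrite /= ger0_norm//.
have mcf : measurable_fun setT (fun x => expR (- (c * f x))).
  apply: (measurableT_comp (@measurable_expR R)).
  by apply: measurable_funN; exact: measurable_funM.
have e1 : (fun x => expR (- (c * f x))) \in Lfun mu 1.
  apply: Lfun_subset12; first exact: fin_num_measure.
  apply: Lfun2_bounded => // x.
  by rewrite expR_ge0 expR_le1 oppr_le0 mulr_ge0.
set E := expR (- (c * k)).
have E0 : 0 < E by exact: expR_gt0.
have tangent x : E * (1 + c * k) <= expR (- (c * f x)) + (E * c) * f x.
  have -> : - (c * f x) = - (c * k) + (c * k - c * f x) by ring.
  rewrite expRD -/E.
  have := ler_wpM2l (ltW E0) (expR_ge1Dx (c * k - c * f x)).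
  lra.
have k0 : 0 <= k by rewrite fine_ge0// expectation_ge0.
have : ((E * (1 + c * k))%:E <=
    'E_mu[((fun x => expR (- (c * f x))) \+ (E * c) \o* f)%R])%E.
  rewrite -(expectation_cst mu); apply: expectation_le => //.
  - by apply: measurable_funD => //; exact: measurable_funM.
  - by move=> x; rewrite mulr_ge0 ?addr_ge0 ?mulr_ge0// ltW.
  - by move=> x /=; rewrite addr_ge0 ?expR_ge0// !mulr_ge0// ltW.
  - by apply: aeW => x /=; rewrite [f x * _]mulrC.
rewrite expectationD//; last exact: Lfun_scale.
rewrite expectationZl// EfE -(fineK (expectation_fin_num e1)) -EFinM -EFinD lee_fin.
lra.
Qed.

End expectation_bounds.

(** * From sample averages to evidences and information gains *)

Section evidence_bounds.
Context {R : realType} (n d r : nat) (Gn : 'M[R]_r) (W : 'M[R]_(r, d)).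
Context (covG : covariance_mx Gn) (uG : Gn \in unitmx).
Implicit Types (F G : 'cV[R]_n -> 'cV[R]_d) (y : 'cV[R]_r).
Local Notation s := (sensitivity Gn W).

Lemma evidence_dist_le F G nin (ms : nat -> 'cV[R]_n) y e : 0 <= e ->
  \sum_(j < nin) Num.min 1 (s * sqnorm (F (ms j) - G (ms j)))
    <= 4 * (s * e ^+ 2) * nin%:R ->
  `|evidence Gn W F nin ms y - evidence Gn W G nin ms y| <= 2 * Num.sqrt s * e.
Proof.
move=> e0 sum_le; have s0 : 0 <= s by exact: sensitivity_ge0.
rewrite /evidence -mulrBr -sumrB.
rewrite -ler_sqr ?nnegrE// ?mulr_ge0// ?sqrtr_ge0// real_normK ?num_real//.
apply: le_trans (sqr_mean_le _) _.
rewrite !exprMn sqr_sqrtr//.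
apply: (@le_trans _ _ (nin%:R^-1 * (4 * (s * e ^+ 2) * nin%:R))).
  rewrite ler_wpM2l ?invr_ge0//; apply: le_trans sum_le.
  by apply: ler_sum => j _; exact: likelihood_dist_sqr.
have [->|n0] := eqVneq nin 0%N.
  by rewrite invr0 mul0r !mulr_ge0 ?sqr_ge0.
rewrite mulrC mulfK ?pnatr_eq0//.
by rewrite le_eqVlt; apply/orP; left; apply/eqP; ring.
Qed.

(** What the evidence at [y] eventually exceeds when the map has second moment [k]:
    the lower bound [exp (- s k)] on the mean of [exp (- s |G|^2)] by Jensen's
    inequality, with a factor 4 lost in the law of large numbers. *)
Definition evidence_floor (k : R) y : R :=
  expR (- weighted_sqnorm Gn y) * (expR (- (s * k)) / 4).

Lemma evidence_floor_gt0 k y : 0 < evidence_floor k y.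
Proof. by rewrite mulr_gt0 ?divr_gt0 ?expR_gt0. Qed.

Lemma evidence_ge G nin (ms : nat -> 'cV[R]_n) y k : (0 < nin)%N ->
  expR (- (s * k)) / 4 * nin%:R <= \sum_(j < nin) expR (- (s * sqnorm (G (ms j)))) ->
  evidence_floor k y <= evidence Gn W G nin ms y.
Proof.
move=> n0 sum_ge; rewrite /evidence ler_pdivlMl ?ltr0n// mulrC /evidence_floor -mulrA.
apply: (@le_trans _ _ (expR (- weighted_sqnorm Gn y) *
    \sum_(j < nin) expR (- (s * sqnorm (G (ms j)))))).
  by rewrite ler_wpM2l// expR_ge0.
by rewrite mulr_sumr; apply: ler_sum => j _; exact: likelihood_ge.
Qed.

(** The numerators cancel, so the two estimators differ by averages of differences of
    logarithms of evidences; the logarithm is Lipschitz above a positive floor. *)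
Lemma eig_estimator_dist_le F G nout nin (m : 'I_nout -> 'cV[R]_n)
    (ms : 'I_nout -> nat -> 'cV[R]_n) (y : 'I_nout -> 'cV[R]_r) kF kG K :
  (forall i, evidence_floor kF (y i) <= evidence Gn W F nin (ms i) (y i)) ->
  (forall i, evidence_floor kG (y i) <= evidence Gn W G nin (ms i) (y i)) ->
  (forall i, `|evidence Gn W F nin (ms i) (y i)
               - evidence Gn W G nin (ms i) (y i)| <= K) ->
  `|eig_estimator Gn W F F nin m ms y - eig_estimator Gn W F G nin m ms y| <=
  (\sum_i ((evidence_floor kF (y i))^-1 + (evidence_floor kG (y i))^-1)) * K.
Proof.
move=> geF geG dist.
rewrite /eig_estimator -mulrBr -sumrB normrM ger0_norm ?invr_ge0//.
apply: (@le_trans _ _ (1 * `|\sum_(i < nout)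
  (ln (likelihood Gn W F (y i) (m i) / evidence Gn W F nin (ms i) (y i)) -
   ln (likelihood Gn W F (y i) (m i) / evidence Gn W G nin (ms i) (y i)))|)).
  rewrite ler_wpM2r//; case: (nout) => [|l]; first by rewrite invr0.
  by rewrite invf_le1 ?ler1n// ltr0n.
rewrite mul1r (le_trans (ler_norm_sum _ _ _))// mulr_suml.
apply: ler_sum => i _.
have l0 : 0 < likelihood Gn W F (y i) (m i) by exact: expR_gt0.
have F0 := lt_le_trans (evidence_floor_gt0 kF (y i)) (geF i).
have G0 := lt_le_trans (evidence_floor_gt0 kG (y i)) (geG i).
rewrite !ln_div// ?posrE// opprB addrC addrA subrK distrC.
apply: le_trans (ln_dist_le F0 G0) _.
rewrite mulrC; apply: ler_pM => //; first by rewrite addr_ge0// invr_ge0 ltW.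
by apply: lerD; rewrite lef_pV2// posrE// evidence_floor_gt0.
Qed.

End evidence_bounds.

Theorem theorem1 (R : realType) (n d r nout : nat)
    (mu : probability 'cV[R]_n R) (m_pr : 'cV[R]_n) (Gpr : 'M[R]_n)
    (F : 'cV[R]_n -> 'cV[R]_d)
    (W : 'M[R]_(r, d))
    (nu : probability 'cV[R]_r R) (Gn : 'M[R]_r)
    (dO : measure_display) (Omega : measurableType dO)
    (P : probability Omega R)
    (m : 'I_nout -> Omega -> 'cV[R]_n)
    (eta : 'I_nout -> Omega -> 'cV[R]_r)
    (ms : 'I_nout -> nat -> Omega -> 'cV[R]_n) :
  let y := fun (w : Omega) (i : 'I_nout) => W *m F (m i w) + eta i w in
  (0 < nout)%N ->
  (* prior and noise laws *)
  covariance_mx Gpr -> Gpr \in unitmx -> gaussian mu m_pr Gpr ->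
  covariance_mx Gn -> Gn \in unitmx -> gaussian nu 0 Gn ->
  (* the design *)
  design_mx W ->
  (* the samples *)
  iid_samples P mu m -> iid_samples P nu eta ->
  (forall i, iid_samples P mu (ms i)) ->
  (* regularity of F making the two eigenvalue problems meaningful *)
  measurable_fun setT F ->
  {ae mu, forall x, differentiable F x} ->
  (forall i j, mu.-integrable setT
     (fun x => (((jac F x)^T *m jac F x) i j)%:E)) ->
  ('E_mu[fun x => sqnorm (F x)] < +oo)%E ->
  (* C_i depends on the surrogate only through its second moment, and on the
     samples only through y_i; in particular not on eps or nin *)
  exists (Ci : 'I_nout -> R -> 'cV[R]_r -> R)
         (C : R -> ('I_nout -> 'cV[R]_r) -> R),
    (forall i k z, 0 < Ci i k z) /\ (forall k z, 0 < C k z) /\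
    forall (D : dipnet R n d) (eps : R),
      let Ft := dipnet_map D in
      dipnet_of mu Gpr F D ->
      ('E_mu[fun x => sqnorm (Ft x)] < +oo)%E ->
      0 <= eps ->
      ('E_mu[fun x => sqnorm (F x - Ft x)] <= (eps ^+ 2)%:E)%E ->
      let k := fine ('E_mu[fun x => sqnorm (Ft x)])%E in
      {ae P, forall w, \forall nin \near \oo,
        (forall i, `| evidence Gn W F nin (ms i ^~ w) (y w i)
                      - evidence Gn W Ft nin (ms i ^~ w) (y w i) |
                   <= Ci i k (y w i) * eps) /\
        `| eig_estimator Gn W F F nin (m ^~ w) (fun i j => ms i j w) (y w)
           - eig_estimator Gn W F Ft nin (m ^~ w) (fun i j => ms i j w) (y w) |
        <= C k (y w) * eps}.
Proof.
move=> y nout0 covGpr uGpr gmu covGn uGn gnu designW iidm iideta iidms mF dF intJ EF.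
pose s := sensitivity Gn W.
pose kF := fine ('E_mu[fun x => sqnorm (F x)])%E.
(* The summand 1 only serves to make the constant positive when s = 0. *)
pose K : R := 2 * Num.sqrt s + 1.
pose weight k z := (evidence_floor Gn W kF z)^-1 + (evidence_floor Gn W k z)^-1.
have K0 : 0 < K by rewrite ltr_wpDl// mulr_ge0// sqrtr_ge0.
have weight_ge0 k z : 0 <= weight k z.
  by rewrite addr_ge0// invr_ge0 ltW// evidence_floor_gt0.
exists (fun _ _ _ => K), (fun k z => (\sum_i weight k (z i)) * K + 1).
split; first by [].
split=> [k z|D eps Ft _ EFt eps0 Eerr k].
  by rewrite ltr_wpDl// mulr_ge0 ?sumr_ge0// ltW.
have mFt : measurable_fun setT Ft.
  exact: (continuous_measurable_fun_mx (@dipnet_map_continuous R n d D)).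
have s0 : 0 <= s by exact: sensitivity_ge0.
pose err x := sqnorm (F x - Ft x).
have merr : measurable_fun setT err by exact: measurable_sqnormB.
have err_ge0 x : 0 <= err x by exact: sqnorm_ge0.
have error_law i : {ae P, forall w, \forall nin \near \oo,
    \sum_(j < nin) Num.min 1 (s * err (ms i j w)) <= 4 * (s * eps ^+ 2) * nin%:R}.
  have mh : measurable_fun setT (fun x => Num.min 1 (s * err x)).
    by apply: measurable_minr => //; exact: measurable_funM.
  have h01 x : 0 <= Num.min 1 (s * err x) <= 1.
    by rewrite le_min ler01 mulr_ge0//= ge_min lexx.
  apply: filterS (iid_sum_bounds (iidms i) mh h01) => w; apply: filterS => nin.
  move=> /andP[_ /le_trans]; apply.
  by rewrite ler_wpM2r// ler_wpM2l// expectation_min1_le.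
have evidence_law G i : measurable_fun setT G ->
    ('E_mu[fun x => sqnorm (G x)] < +oo)%E ->
    {ae P, forall w, \forall nin \near \oo,
      expR (- (s * fine ('E_mu[fun x => sqnorm (G x)])%E)) / 4 * nin%:R
        <= \sum_(j < nin) expR (- (s * sqnorm (G (ms i j w))))}.
  move=> mG EG.
  have msq : measurable_fun setT (fun x => sqnorm (G x)).
    exact: measurable_sqnorm.
  have mh : measurable_fun setT (fun x => expR (- (s * sqnorm (G x)))).
    apply: (measurableT_comp (@measurable_expR R)).
    by apply: measurable_funN; exact: measurable_funM.
  have h01 x : 0 <= expR (- (s * sqnorm (G x))) <= 1.
    by rewrite expR_ge0 expR_le1 oppr_le0 mulr_ge0// sqnorm_ge0.
  apply: filterS (iid_sum_bounds (iidms i) mh h01) => w; apply: filterS => nin.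
  move=> /andP[+ _]; apply: le_trans.
  rewrite ler_wpM2r// ler_wpM2r//; apply: expectation_expRN_ge => // x.
  exact: sqnorm_ge0.
have law i : {ae P, forall w, \forall nin \near \oo,
    [/\ \sum_(j < nin) Num.min 1 (s * err (ms i j w))
          <= 4 * (s * eps ^+ 2) * nin%:R,
        evidence_floor Gn W kF (y w i) <= evidence Gn W F nin (ms i ^~ w) (y w i) &
        evidence_floor Gn W k (y w i) <= evidence Gn W Ft nin (ms i ^~ w) (y w i)]}.
  apply: filterS3 (error_law i) (evidence_law _ F i mF EF)
    (evidence_law _ Ft i mFt EFt) => w errw Fw Ftw.
  near=> nin; have nin0 : (0 < nin)%N by near: nin; exact: nbhs_infty_gt.
  by split; [|apply: evidence_ge|apply: evidence_ge] => //; near: nin.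
apply: filterS (filter_forall _ law) => w law_w.
apply: filterS (filter_forall _ law_w) => nin law_n.
have dist i : `|evidence Gn W F nin (ms i ^~ w) (y w i)
    - evidence Gn W Ft nin (ms i ^~ w) (y w i)| <= K * eps.
  have [errn _ _] := law_n i.
  apply: le_trans (evidence_dist_le covGn uGn (y w i) eps0 errn) _.
  by rewrite ler_wpM2r// lerDl.
split=> //.
apply: (@le_trans _ _ ((\sum_i weight k (y w i)) * (K * eps))).
  by apply: eig_estimator_dist_le => // i; have [] := law_n i.
by rewrite mulrA ler_wpM2r// lerDl.
Unshelve. all: by end_near. Qed.
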